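(* (i) Let $\{f_k\}_{k=1}^d$ be a collection of linearly independent vectors in $\mathbb{C}^d$, let $\varphi\in\mathbb{C}^d$ be an arbitrary vector, and let $n\ge d$ be an integer. Define the linear map $T:\mathbb{C}^d\to\mathbb{C}^d$ by $Tf_k=f_{k+1}$ for $k=1,\dots,d-1$, and $Tf_d=\varphi$. Then $\{T^{k-1}f_1\}_{k=1}^n$ is a frame for $\mathbb{C}^d$. (ii) Conversely, any dynamical frame $\{T^{k-1}f_1\}_{k=1}^n$ for $\mathbb{C}^d$ (with $T:\mathbb{C}^d\to\mathbb{C}^d$ linear and $f_1\in\mathbb{C}^d$) arises as in (i), with $f_k=T^{k-1}f_1$ for $k=2,\dots,d$ and $\varphi=Tf_d$; that is, $n\ge d$, the vectors $\{f_k\}_{k=1}^d$ are linearly independent, and $T$ is the linear map determined by $Tf_k=f_{k+1}$ for $k=1,\dots,d-1$ and $Tf_d=\varphi$.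
   Context: A finite family $\{g_k\}_{k=1}^n$ (repetitions allowed) is a frame for $\mathbb{C}^d$ if there are constants $A,B>0$ with $A\|f\|^2\le\sum_{k=1}^n|\langle f,g_k\rangle|^2\le B\|f\|^2$ for all $f\in\mathbb{C}^d$; equivalently, if it spans $\mathbb{C}^d$. A frame $\{f_k\}_{k=1}^n$ for $\mathbb{C}^d$ is called a dynamical frame if there exists a linear operator $T:\mathbb{C}^d\to\mathbb{C}^d$ such that $f_k=T^{k-1}f_1$ for $1\le k\le n$. *)

(* Defs.v *)
(* The complex numbers are R[i] for R : realType. *)
From mathcomp Require Export all_boot all_order all_algebra spectral.
From mathcomp Require Export reals complex.

Set Implicit Arguments.
Unset Strict Implicit.
Unset Printing Implicit Defensive.

Import GRing.Theory Num.Theory.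
Local Open Scope ring_scope.

(* The vectors f_1, ..., f_d of a family indexed from 1 are f 0, ..., f (d - 1)
   here, and {f_k}_{k=1}^d is a function on 'I_d (so repetitions count). *)
Definition ord_first (d : nat) (hd : (0 < d)%N) : 'I_d := Ordinal hd.
Definition ord_last (d : nat) (hd : (0 < d)%N) : 'I_d := rev_ord (ord_first hd).

(* dotmx u v = \sum_j u_j * (v_j)^*; the order of R[i] restricts to the usual
   order on the reals, and all three members below are real. *)
Definition is_frame (R : realType) (d n : nat) (g : 'I_n -> 'rV[R[i]]_d) : Prop :=
  exists A B : R,
    [/\ 0 < A, 0 < B &
      forall f : 'rV[R[i]]_d,
        A%:C%C * dotmx f f <= \sum_(k < n) `|dotmx f (g k)| ^+ 2
        /\ \sum_(k < n) `|dotmx f (g k)| ^+ 2 <= B%:C%C * dotmx f f].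

(* The hypothesis on i avoids a separate case for n = 0. *)
Definition is_dynamical_frame (R : realType) (d n : nat)
    (g : 'I_n -> 'rV[R[i]]_d) : Prop :=
  is_frame g
  /\ exists T : 'End('rV[R[i]]_d),
       forall i k : 'I_n, i = 0%N :> nat -> g k = iter k T (g i).

Definition linearly_independent (R : realType) (d m : nat)
    (f : 'I_m -> 'rV[R[i]]_d) : Prop :=
  free [seq f k | k : 'I_m].

Definition is_shift_map (R : realType) (d : nat) (hd : (0 < d)%N)
    (f : 'I_d -> 'rV[R[i]]_d) (phi : 'rV[R[i]]_d)
    (T : 'End('rV[R[i]]_d)) : Prop :=
  (forall k k' : 'I_d, k' = k.+1 :> nat -> T (f k) = f k')
  /\ T (f (ord_last hd)) = phi.

Definition orbit_family (R : realType) (d : nat) (T : 'End('rV[R[i]]_d))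
    (f1 : 'rV[R[i]]_d) (n : nat) : 'I_n -> 'rV[R[i]]_d :=
  fun k => iter k T f1.

(* Main.v *)
Require Import Defs.

Set Implicit Arguments.
Unset Strict Implicit.
Unset Printing Implicit Defensive.

Import Order.TTheory GRing.Theory Num.Theory.
Local Open Scope ring_scope.
Local Open Scope sesquilinear_scope.

(** Stack a family g of n row vectors as the rows of a matrix G.  Everything
    becomes a statement about the rank of such matrices: the family is a frame
    exactly when G has full row space ([is_frameP]), and it is linearly
    independent exactly when the rows of G are free ([linearly_independentP]).
    For a family of d vectors in dimension d these two conditions coincide,
    since both say that the square matrix G is invertible.

    For (i), a map on C^d can be prescribed freely on a basis, so T exists and
    is unique; the first d vectors of the orbit of f_1 are f_1, ..., f_d by
    construction, so the orbit already spans after d steps, and a longer piece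
    of it spans too.

    For (ii), the point is that no orbit leaves the span of its first d terms
    ([orbit_sub_first]): by the Cayley-Hamilton theorem every power of T is a
    combination of its first d powers.  So if some finite piece of the orbit
    spans C^d, its first d terms already span, hence form a basis; T is then
    determined by its values on them.  The bound d <= n holds because n vectors
    span a space of dimension at most n. *)

Definition family_mx (F : Type) (n d : nat) (g : 'I_n -> 'rV[F]_d) : 'M[F]_(n, d) :=
  \matrix_(k < n) g k.

Lemma mul_family_mx (F : pzRingType) (n d : nat) (g : 'I_n -> 'rV[F]_d)
    (v : 'rV[F]_n) :
  v *m family_mx g = \sum_(k < n) v 0 k *: g k.
Proof. by rewrite mulmx_sum_row; apply: eq_bigr => k _; rewrite rowK. Qed.

Lemma dotmx_normsq (C : numClosedFieldType) (n : nat) (u : 'rV[C]_n) :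
  dotmx u u = \sum_(k < n) `|u 0 k| ^+ 2.
Proof. by rewrite dotmxE mxE; apply: eq_bigr => k _; rewrite normCK !mxE. Qed.

Lemma mulmx_conj_family (C : numClosedFieldType) (n d : nat)
    (g : 'I_n -> 'rV[C]_d) (f : 'rV[C]_d) (k : 'I_n) :
  (f *m (family_mx g)^t*) 0 k = dotmx f (g k).
Proof. by rewrite dotmxE !mxE; apply: eq_bigr => j _; rewrite !mxE. Qed.

(** The frame sum is the squared norm of the analysis operator applied to f, so
    that both frame inequalities compare f with its image under one matrix. *)
Lemma frame_sum_normsq (C : numClosedFieldType) (n d : nat) (g : 'I_n -> 'rV[C]_d)
    (f : 'rV[C]_d) :
  \sum_(k < n) `|dotmx f (g k)| ^+ 2
    = dotmx (f *m (family_mx g)^t*) (f *m (family_mx g)^t*).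
Proof.
by rewrite dotmx_normsq; apply: eq_bigr => k _; rewrite mulmx_conj_family.
Qed.

Lemma dotmx_ge0 (C : numClosedFieldType) (n : nat) (u : 'rV[C]_n) : 0 <= dotmx u u.
Proof. by rewrite dotmx_normsq sumr_ge0 // => k _; rewrite exprn_ge0. Qed.

(** By Cauchy-Schwarz on each column of M, the sum of the squared norms of the
    columns is such a constant.  For the analysis matrix this gives the upper
    frame bound, and for a one-sided inverse of it the lower one. *)
Lemma mulmx_bounded (R : realType) (m n : nat) (M : 'M[R[i]]_(m, n)) :
  exists2 c : R, 0 < c &
    forall v : 'rV_m, dotmx (v *m M) (v *m M) <= c%:C%C * dotmx v v.
Proof.
pose S := \sum_(j < n) dotmx ((col j M)^t*) ((col j M)^t*).
have S_ge0 : 0 <= S by rewrite sumr_ge0 // => j _; exact: dotmx_ge0.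
have SE : (complex.Re S)%:C%C = S by rewrite RRe_real // ger0_real.
(* The summand 1 keeps the constant positive when M = 0. *)
exists (complex.Re S + 1) => [|v].
  by rewrite ltr_pwDr ?ltr01 // -lecR SE.
apply: (@le_trans _ _ (S * dotmx v v)); last first.
  by rewrite ler_wpM2r ?dotmx_ge0 // rmorphD /= SE lerDl ler01.
rewrite dotmx_normsq /S mulr_suml ler_sum // => j _.
have -> : (v *m M) 0 j = dotmx v ((col j M)^t*).
  by rewrite dotmxE trmxCK !mxE; apply: eq_bigr => i _; rewrite !mxE.
by rewrite mulrC; exact: CauchySchwarz.
Qed.

(** The lower frame bound makes the analysis map injective, which says that its
    matrix, the conjugate transpose of G, has rank d.  Conversely, a left inverse
    P of G conjugates to a bounded left inverse of the analysis map, and its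
    bound c yields the lower frame bound 1 / c. *)
Lemma is_frameP (R : realType) (d n : nat) (g : 'I_n -> 'rV[R[i]]_d) :
  is_frame g <-> row_full (family_mx g).
Proof.
set G := family_mx g; split=> [[A [B [A_gt0 _ gAB]]] | /row_fullP[P PG]].
  have Gt_free : row_free (G^t*).
    apply: inj_row_free => f fG0; apply/eqP/negPn/negP => f_neq0.
    have [+ _] := gAB f; rewrite frame_sum_normsq fG0 !linear0l.
    have lhs_gt0 : 0 < A%:C%C * dotmx f f.
      by rewrite mulr_gt0 ?(ltcR 0) //; exact: dotmx_is_dotmx.
    by move=> /(lt_le_trans lhs_gt0); rewrite ltxx.
  by rewrite /row_full -mxrank_tr -(mxrank_map Num.conj).
have [B B_gt0 GB] := mulmx_bounded (G^t*).
have [c c_gt0 Pc] := mulmx_bounded (P^t*).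
exists c^-1, B; split=> // [|f]; first by rewrite invr_gt0.
rewrite frame_sum_normsq; split; last exact: GB.
rewrite fmorphV ler_pdivrMl ?(ltcR 0) //.
have := Pc (f *m G^t*); rewrite -mulmxA.
suff -> : G^t* *m P^t* = 1%:M by rewrite mulmx1.
by rewrite -map_mxM -trmx_mul PG trmx1 map_mx1.
Qed.

Lemma linearly_independentP (R : realType) (d m : nat) (f : 'I_m -> 'rV[R[i]]_d) :
  linearly_independent f <-> row_free (family_mx f).
Proof.
have nthf (k : 'I_m) : [seq f k | k : 'I_m]`_k = f k.
  rewrite (nth_map k) ?size_enum_ord //.
  by rewrite nth_ord_enum.
have szf : size [seq f k | k : 'I_m] == m by rewrite size_map size_enum_ord.
have sumE (c : 'I_m -> R[i]) :
    \sum_(k < m) c k *: (Tuple szf)`_k = (\row_k c k) *m family_mx f.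
  by rewrite mul_family_mx; apply: eq_bigr => k _; rewrite nthf mxE.
split=> [/(@freeP _ _ _ (Tuple szf)) f_free | F_free].
  apply: inj_row_free => v vF0; apply/rowP => k; rewrite mxE.
  apply: f_free; rewrite sumE -[RHS]vF0; congr (_ *m _).
  by apply/rowP => j; rewrite mxE.
apply/(@freeP _ _ _ (Tuple szf)) => c; rewrite sumE => cF0 k.
have /rowP/(_ k) : \row_k c k = 0.
  by apply: (row_free_inj F_free); rewrite cF0 mul0mx.
by rewrite !mxE.
Qed.

Lemma row_full_free (F : fieldType) (d : nat) (A : 'M[F]_d) : row_full A = row_free A.
Proof. by rewrite row_full_unit row_free_unit. Qed.

(** The prescribed images f_2, ..., f_d, phi as a single family: the default
    value phi of [insub] is reached exactly at the last index. *)
Definition shift_target (U : Type) (d : nat) (f : 'I_d -> U) (phi : U)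
    (k : 'I_d) : U :=
  if insub k.+1 is Some k' then f k' else phi.

Lemma is_shift_mapP (R : realType) (d : nat) (hd : (0 < d)%N)
    (f : 'I_d -> 'rV[R[i]]_d) (phi : 'rV[R[i]]_d) (T : 'End('rV[R[i]]_d)) :
  is_shift_map hd f phi T <-> forall k, T (f k) = shift_target f phi k.
Proof.
rewrite /shift_target; split=> [[Tf Tlast] k | Tf].
  case: insubP => [k' _ /Tf //|]; rewrite -leqNgt => d_le.
  rewrite -Tlast; congr (T (f _)); apply/val_inj => /=; apply/eqP.
  by rewrite eqn_leq -ltnS subn1 prednK // ltn_ord -ltnS prednK.
split=> [k k' k'E|]; rewrite Tf; case: insubP => [j|] //=.
- by move=> _ jE; congr f; apply/val_inj; rewrite /= jE -k'E.
- by rewrite -k'E ltn_ord.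
by rewrite subn1 prednK // ltnn.
Qed.

Lemma linear_eq_on_spanning (F : fieldType) (d n : nat) (V : vectType F)
    (f : 'I_n -> 'rV[F]_d) (S T : 'Hom('rV[F]_d, V)) :
  row_full (family_mx f) -> (forall k, S (f k) = T (f k)) -> S = T.
Proof.
move=> /row_fullP[P PF] STf; apply/lfunP => v.
rewrite -[v]mulmx1 -PF mulmxA mul_family_mx !linear_sum.
by apply: eq_bigr => k _; rewrite !linearZ /= STf.
Qed.

(** If F is the matrix of f, then right multiplication by F^-1 takes f_k to the
    k-th unit vector, which the matrix of targets takes to the desired image. *)
Lemma shift_map_exists (R : realType) (d : nat) (hd : (0 < d)%N)
    (f : 'I_d -> 'rV[R[i]]_d) (phi : 'rV[R[i]]_d) :
  linearly_independent f -> exists T, is_shift_map hd f phi T.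
Proof.
move=> /linearly_independentP; rewrite -row_full_free => /row_fullP[P PF].
have FP : family_mx f *m P = 1%:M by apply: mulmx1C.
exists (linfun (mulmxr (P *m family_mx (shift_target f phi)))).
apply/is_shift_mapP => k; rewrite lfunE /= -[f k](rowK f k) -/(family_mx f).
by rewrite mulmxA -row_mul FP -row_mul mul1mx rowK.
Qed.

Lemma shift_map_unique (R : realType) (d : nat) (hd : (0 < d)%N)
    (f : 'I_d -> 'rV[R[i]]_d) (phi : 'rV[R[i]]_d) (S T : 'End('rV[R[i]]_d)) :
  linearly_independent f ->
  is_shift_map hd f phi S -> is_shift_map hd f phi T -> S = T.
Proof.
move=> /linearly_independentP; rewrite -row_full_free => F_full.
move=> /is_shift_mapP Sf /is_shift_mapP Tf.
by apply: (linear_eq_on_spanning F_full) => k; rewrite Sf Tf.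
Qed.

Lemma shift_map_orbit (R : realType) (d : nat) (hd : (0 < d)%N)
    (f : 'I_d -> 'rV[R[i]]_d) (phi : 'rV[R[i]]_d) (T : 'End('rV[R[i]]_d)) :
  is_shift_map hd f phi T -> forall k : 'I_d, iter k T (f (ord_first hd)) = f k.
Proof.
move=> [Tf _] [k k_lt_d] /=; elim: k k_lt_d => [|k IHk] k_lt_d /=.
  by congr f; apply/val_inj.
by rewrite (IHk (ltnW k_lt_d)); apply: Tf.
Qed.

Lemma family_mx_full_sub (F : fieldType) (d m n : nat)
    (f : 'I_m -> 'rV[F]_d) (g : 'I_n -> 'rV[F]_d) :
  (forall k, (f k <= family_mx g)%MS) ->
  row_full (family_mx f) -> row_full (family_mx g).
Proof.
move=> fg; rewrite -!sub1mx => /submx_trans; apply.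
by apply/row_subP => k; rewrite rowK.
Qed.

Lemma iter_mulmx (F : fieldType) (d : nat) (T : 'End('rV[F]_d.+1)) (v : 'rV_d.+1)
    (k : nat) :
  iter k T v = v *m lin1_mx T ^+ k.
Proof.
elim: k => [|k IHk]; first by rewrite expr0 mulmx1.
by rewrite exprSr mulmxA -IHk mul_rV_lin1.
Qed.

(** The remainder r of X^k modulo the characteristic polynomial has degree less
    than d and, by Cayley-Hamilton, takes the same value as X^k at the matrix of
    T.  Its coefficients therefore express T^k v through v, ..., T^(d-1) v. *)
Lemma orbit_sub_first (R : realType) (d : nat) (T : 'End('rV[R[i]]_d))
    (v : 'rV[R[i]]_d) (k : nat) :
  (iter k T v <= family_mx (orbit_family T v (n := d)))%MS.
Proof.
case: d T v => [|d] T v; first by rewrite thinmx0 sub0mx.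
set A := lin1_mx T.
pose r := 'X^k %% char_poly A.
have r_size : (size r <= d.+1)%N.
  rewrite -ltnS -(size_char_poly A) ltn_modp.
  by rewrite monic_neq0 // char_poly_monic.
have AkE : A ^+ k = horner_mx A r.
  transitivity (horner_mx A 'X^k); first by rewrite rmorphXn /= horner_mx_X.
  rewrite {1}(divp_eq 'X^k (char_poly A)).
  by rewrite rmorphD rmorphM /= Cayley_Hamilton mulr0 add0r.
have rE : r = \sum_(i < d.+1) r`_i *: 'X^i.
  rewrite -poly_def; apply/polyP => i; rewrite coef_poly.
  by case: ltnP => // /(leq_trans r_size)/leq_sizeP->.
suff -> : iter k T v =
    (\row_(i < d.+1) r`_i) *m family_mx (orbit_family T v (n := d.+1)).
  exact: submxMl.
rewrite iter_mulmx -/A AkE mul_family_mx [in LHS]rE rmorph_sum mulmx_sumr.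
apply: eq_bigr => i _ /=.
rewrite linearZ /= rmorphXn /= horner_mx_X -scalemxAr mxE.
by rewrite /orbit_family iter_mulmx.
Qed.

Theorem theorem2p3 (R : realType) (d : nat) (hd : (0 < d)%N) :
  (forall (f : 'I_d -> 'rV[R[i]]_d) (phi : 'rV[R[i]]_d) (n : nat),
     linearly_independent f -> (d <= n)%N ->
     (exists! T : 'End('rV[R[i]]_d), is_shift_map hd f phi T)
     /\ forall T : 'End('rV[R[i]]_d), is_shift_map hd f phi T ->
          is_frame (orbit_family T (f (ord_first hd)) (n := n)))
  /\
  (forall (n : nat) (T : 'End('rV[R[i]]_d)) (f1 : 'rV[R[i]]_d),
     is_dynamical_frame (orbit_family T f1 (n := n)) ->
     let f := orbit_family T f1 (n := d) in
     let phi := T (f (ord_last hd)) in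
     [/\ (d <= n)%N,
         linearly_independent f &
         unique (fun S : 'End('rV[R[i]]_d) => is_shift_map hd f phi S) T]).
Proof.
split=> [f phi n f_free le_dn | n T f1 [/is_frameP G_full _] f phi].
  split=> [|T shT].
    have [T shT] := shift_map_exists hd phi f_free.
    by exists T; split=> // S; apply: shift_map_unique f_free shT.
  apply/is_frameP; move/linearly_independentP: f_free; rewrite -row_full_free.
  apply: family_mx_full_sub => k; rewrite -(shift_map_orbit shT k).
  have := row_sub (widen_ord le_dn k)
    (family_mx (orbit_family T (f (ord_first hd)) (n := n))).
  by rewrite rowK.
have f_free : linearly_independent f.
  apply/linearly_independentP; rewrite -row_full_free.
  by apply: family_mx_full_sub G_full => k; exact: orbit_sub_first.
split=> //; first by rewrite -(eqP G_full) rank_leq_row.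
have shT : is_shift_map hd f phi T.
  by split=> // k k' k'E; rewrite /f /orbit_family k'E.
by split=> // S; apply: shift_map_unique f_free shT.
Qed.
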